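(* Let $R$ be a non-reduced local Gaussian ring with nilradical $\mathcal{N}$. If $\mathcal{N}^2\neq 0$, then the weak global dimension of $R$ is $\infty$.
   Context: All rings are commutative with unit; a local ring is a ring with a unique maximal ideal (not necessarily Noetherian). For a polynomial $f\in R[x]$, the content $c(f)$ is the ideal of $R$ generated by the coefficients of $f$. The polynomial $f$ is called Gaussian if $c(f)c(g)=c(fg)$ for all $g\in R[x]$, and the ring $R$ is called Gaussian if every polynomial in $R[x]$ is Gaussian. The flat dimension $\mathrm{fd}(M)$ of an $R$-module $M$ is the smallest $n$ such that there is a resolution $0\to F_n\to\cdots\to F_0\to M\to 0$ by flat $R$-modules, and $\infty$ if no finite such resolution exists. The weak global dimension of $R$ is $\sup\{\mathrm{fd}(M)\mid M \text{ an } R\text{-module}\}$. *)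

(* Defs.v *)
From HB Require Import structures.
From mathcomp Require Import all_boot all_order all_algebra.
From mathcomp Require Import boolp classical_sets.

Set Implicit Arguments.
Unset Strict Implicit.
Unset Printing Implicit Defensive.

Import GRing.Theory.
Local Open Scope classical_set_scope.
Local Open Scope ring_scope.
Local Open Scope quotient_scope.

Section Ideals.
Variable R : comNzRingType.
Implicit Types (I J m : set R) (f g : {poly R}).

Definition is_ideal I : Prop :=
  [/\ I 0, forall x y, I x -> I y -> I (x + y) & forall a x, I x -> I (a * x)].

Definition ideal_gen (A : set R) : set R := smallest is_ideal A.

Definition ideal_mul I J : set R :=
  ideal_gen [set z | exists x y, [/\ I x, J y & z = x * y]].

Definition is_maximal_ideal m : Prop :=
  [/\ is_ideal m, m <> setT &
      forall I, is_ideal I -> m `<=` I -> I <> setT -> I = m].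

Definition local_ring : Prop := exists! m, is_maximal_ideal m.

Definition nilradical : set R := [set x | exists n : nat, x ^+ n = 0].

Definition reduced_ring : Prop := forall x, nilradical x -> x = 0.

Definition content f : set R := ideal_gen [set a | exists i : nat, a = f`_i].

Definition gaussian_poly f : Prop :=
  forall g, ideal_mul (content f) (content g) = content (f * g).

Definition gaussian_ring : Prop := forall f, gaussian_poly f.

End Ideals.

Arguments local_ring R : clear implicits.
Arguments nilradical R : clear implicits.
Arguments reduced_ring R : clear implicits.
Arguments gaussian_ring R : clear implicits.

(* The tensor product is the set of formal sums m1 # n1 + ... + mk # nk,
   encoded as lists of pairs, modulo the least congruence for concatenation
   containing the relations below.  No formal inverses are needed:
   the relation 0 # n = 0 makes (- m) # n the opposite of m # n. *)
Section Tensor.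
Variables (R : comNzRingType) (M N : lmodType R).

Inductive tensor_rel : seq (M * N) -> seq (M * N) -> Prop :=
| tensor_refl s : tensor_rel s s
| tensor_sym s t : tensor_rel s t -> tensor_rel t s
| tensor_trans s t u : tensor_rel s t -> tensor_rel t u -> tensor_rel s u
| tensor_cat s s' t t' :
    tensor_rel s s' -> tensor_rel t t' -> tensor_rel (s ++ t) (s' ++ t')
| tensor_comm s t : tensor_rel (s ++ t) (t ++ s)
| tensor_0l n : tensor_rel [:: (0, n)] [::]
| tensor_Dl m m' n : tensor_rel [:: (m + m', n)] [:: (m, n); (m', n)]
| tensor_Dr m n n' : tensor_rel [:: (m, n + n')] [:: (m, n); (m, n')]
| tensor_Z a m n : tensor_rel [:: (a *: m, n)] [:: (m, a *: n)].

Definition tensor_relb : rel (seq (M * N)) := fun s t => `[< tensor_rel s t >].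

Fact tensor_relb_refl : reflexive tensor_relb.
Proof. by move=> s; apply/asboolP; exact: tensor_refl. Qed.

Fact tensor_relb_sym : symmetric tensor_relb.
Proof. by move=> s t; apply/asboolP/asboolP; exact: tensor_sym. Qed.

Fact tensor_relb_trans : transitive tensor_relb.
Proof.
by move=> t s u /asboolP st /asboolP tu; apply/asboolP; exact: tensor_trans tu.
Qed.

Canonical tensor_equiv :=
  EquivRel tensor_relb tensor_relb_refl tensor_relb_sym tensor_relb_trans.

Definition tensor : Type := {eq_quot tensor_equiv}.

HB.instance Definition _ := Choice.on tensor.
HB.instance Definition _ := Quotient.on tensor.

Definition tensor_of (s : seq (M * N)) : tensor :=
  \pi_({eq_quot tensor_equiv}) s.

Lemma tensor_of_eq s t : (tensor_of s = tensor_of t) <-> tensor_rel s t.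
Proof.
by split=> [/eqP|st]; [|apply/eqP; move: st];
  rewrite /tensor_of eqmodE => /asboolP.
Qed.

Lemma tensor_reprK x : tensor_of (repr x) = x.
Proof. exact: reprK. Qed.

Lemma tensor_ofP x : exists s, x = tensor_of s.
Proof. by exists (repr x); rewrite tensor_reprK. Qed.

Lemma tensor_repr s : tensor_rel (repr (tensor_of s)) s.
Proof. by apply/tensor_of_eq; rewrite tensor_reprK. Qed.

Definition tensor_scale_seq (a : R) (s : seq (M * N)) : seq (M * N) :=
  [seq (a *: p.1, p.2) | p <- s].

Lemma tensor_scale_seq_rel a s t : tensor_rel s t ->
  tensor_rel (tensor_scale_seq a s) (tensor_scale_seq a t).
Proof.
elim=> {s t} /=.
- by move=> s; exact: tensor_refl.
- by move=> s t _; exact: tensor_sym.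
- by move=> s t u _ st _; exact: tensor_trans.
- move=> s s' t t' _ ss _ tt; rewrite /tensor_scale_seq !map_cat.
  exact: tensor_cat.
- by move=> s t; rewrite /tensor_scale_seq !map_cat; exact: tensor_comm.
- by move=> n; rewrite scaler0; exact: tensor_0l.
- by move=> m m' n; rewrite scalerDr; exact: tensor_Dl.
- by move=> m n n'; exact: tensor_Dr.
- move=> b m n; rewrite scalerA mulrC -scalerA; exact: tensor_Z.
Qed.

Definition tensor_add (x y : tensor) : tensor :=
  tensor_of (repr x ++ repr y).
Definition tensor_scale (a : R) (x : tensor) : tensor :=
  tensor_of (tensor_scale_seq a (repr x)).
Definition tensor_zero : tensor := tensor_of [::].
Definition tensor_opp (x : tensor) : tensor := tensor_scale (-1) x.

Lemma tensor_add_pi s t :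
  tensor_add (tensor_of s) (tensor_of t) = tensor_of (s ++ t).
Proof. by apply/tensor_of_eq; apply: tensor_cat; exact: tensor_repr. Qed.

Lemma tensor_scale_pi a s :
  tensor_scale a (tensor_of s) = tensor_of (tensor_scale_seq a s).
Proof. by apply/tensor_of_eq; apply: tensor_scale_seq_rel; exact: tensor_repr. Qed.

Fact tensor_addA : associative tensor_add.
Proof.
move=> x y z; have [s ->] := tensor_ofP x; have [t ->] := tensor_ofP y.
have [u ->] := tensor_ofP z.
by rewrite !tensor_add_pi catA.
Qed.

Fact tensor_addC : commutative tensor_add.
Proof.
move=> x y; have [s ->] := tensor_ofP x; have [t ->] := tensor_ofP y.
rewrite !tensor_add_pi.
by apply/tensor_of_eq; exact: tensor_comm.
Qed.

Fact tensor_add0 : left_id tensor_zero tensor_add.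
Proof. by move=> x; have [s ->] := tensor_ofP x; rewrite tensor_add_pi. Qed.

Fact tensor_scale0 x : tensor_scale 0 x = tensor_zero.
Proof.
have [s ->] := tensor_ofP x; rewrite tensor_scale_pi; apply/tensor_of_eq.
elim: s => [|[m n] s IH] /=; first exact: tensor_refl.
by rewrite scale0r; exact: (tensor_cat (tensor_0l n) IH).
Qed.

Fact tensor_scale1 : left_id 1 tensor_scale.
Proof.
move=> x; have [s ->] := tensor_ofP x; rewrite tensor_scale_pi; congr tensor_of.
by rewrite /tensor_scale_seq -[RHS]map_id; apply: eq_map => -[m n] /=;
  rewrite scale1r.
Qed.

Fact tensor_scaleDl x a b :
  tensor_scale (a + b) x = tensor_add (tensor_scale a x) (tensor_scale b x).
Proof.
have [s ->] := tensor_ofP x; elim: s => [|[m n] s IH].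
  by rewrite !tensor_scale_pi tensor_add_pi.
rewrite -cat1s -!tensor_add_pi.
have sD c y z : tensor_scale c (tensor_add y z) =
    tensor_add (tensor_scale c y) (tensor_scale c z).
  have [t ->] := tensor_ofP y; have [u ->] := tensor_ofP z.
  rewrite tensor_add_pi !tensor_scale_pi tensor_add_pi.
  by rewrite /tensor_scale_seq map_cat.
rewrite !sD IH.
have -> : tensor_scale (a + b) (tensor_of [:: (m, n)]) =
    tensor_add (tensor_scale a (tensor_of [:: (m, n)]))
               (tensor_scale b (tensor_of [:: (m, n)])).
  rewrite !tensor_scale_pi tensor_add_pi; apply/tensor_of_eq => /=.
  by rewrite scalerDl; exact: tensor_Dl.
rewrite -!tensor_addA; congr tensor_add; rewrite !tensor_addA; congr tensor_add.
exact: tensor_addC.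
Qed.

Fact tensor_addN : left_inverse tensor_zero tensor_opp tensor_add.
Proof.
move=> x; rewrite /tensor_opp -[X in tensor_add _ X]tensor_scale1.
by rewrite -tensor_scaleDl addNr tensor_scale0.
Qed.

HB.instance Definition _ :=
  GRing.isZmodule.Build tensor tensor_addA tensor_addC tensor_add0 tensor_addN.

Fact tensor_scaleA a b x :
  tensor_scale a (tensor_scale b x) = tensor_scale (a * b) x.
Proof.
have [s ->] := tensor_ofP x; rewrite !tensor_scale_pi /tensor_scale_seq -map_comp.
by congr tensor_of; apply: eq_map => p /=; rewrite scalerA.
Qed.

Fact tensor_scaleDr : right_distributive tensor_scale +%R.
Proof.
move=> a x y; have [s ->] := tensor_ofP x; have [t ->] := tensor_ofP y.
rewrite [_ + _]tensor_add_pi !tensor_scale_pi [_ + _]tensor_add_pi.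
by rewrite /tensor_scale_seq map_cat.
Qed.

HB.instance Definition _ :=
  GRing.Zmodule_isLmodule.Build R tensor
    tensor_scaleA tensor_scale1 tensor_scaleDr tensor_scaleDl.

Lemma tensor_ofD s t : tensor_of (s ++ t) = tensor_of s + tensor_of t.
Proof. by rewrite [RHS]tensor_add_pi. Qed.

Lemma tensor_ofZ a s : tensor_of (tensor_scale_seq a s) = a *: tensor_of s.
Proof. by rewrite [RHS]tensor_scale_pi. Qed.

Definition pure_tensor (m : M) (n : N) : tensor := tensor_of [:: (m, n)].

Lemma tensor_sum_pure (x : tensor) :
  x = \sum_(p <- repr x) pure_tensor p.1 p.2.
Proof.
rewrite -{1}[x]tensor_reprK; elim: (repr x) => [|[m n] s IH].
  by rewrite big_nil.
by rewrite big_cons -IH -cat1s tensor_ofD.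
Qed.

Definition bilinear_map (P : lmodType R) (b : M -> N -> P) : Prop :=
  [/\ forall m m' n, b (m + m') n = b m n + b m' n,
      forall m n n', b m (n + n') = b m n + b m n',
      forall a m n, b (a *: m) n = a *: b m n &
      forall a m n, b m (a *: n) = a *: b m n].

Lemma pure_tensor_bilinear : bilinear_map pure_tensor.
Proof.
split=> [m m' n|m n n'|a m n|a m n]; rewrite /pure_tensor.
- by rewrite -tensor_ofD; apply/tensor_of_eq; exact: tensor_Dl.
- by rewrite -tensor_ofD; apply/tensor_of_eq; exact: tensor_Dr.
- by rewrite -tensor_ofZ.
- by rewrite -tensor_ofZ; apply/tensor_of_eq/tensor_sym; exact: tensor_Z.
Qed.

Lemma tensor_universal (P : lmodType R) (b : M -> N -> P) : bilinear_map b ->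
  exists h : {linear tensor -> P},
    (forall m n, h (pure_tensor m n) = b m n) /\
    forall h' : {linear tensor -> P},
      (forall m n, h' (pure_tensor m n) = b m n) -> h' =1 h.
Proof.
move=> [bDl bDr bZl bZr].
pose S s := \sum_(p <- s) b p.1 p.2.
have S_rel s t : tensor_rel s t -> S s = S t.
  rewrite /S; elim=> {s t} //=.
  - by move=> s t u _ -> _ ->.
  - by move=> s s' t t' _ es _ et; rewrite !big_cat es et.
  - by move=> s t; rewrite !big_cat /= addrC.
  - move=> n; rewrite big_seq1 big_nil /=.
    by rewrite -(scale0r (0 : M)) bZl scale0r.
  - by move=> m m' n; rewrite !big_cons !big_nil /= !addr0 bDl.
  - by move=> m n n'; rewrite !big_cons !big_nil /= !addr0 bDr.
  - by move=> a m n; rewrite !big_seq1 /= bZl bZr.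
pose h x := S (repr (x : tensor)).
have h_pi s : h (tensor_of s) = S s by apply/S_rel/tensor_repr.
have hL : linear h.
  move=> a x y; have [s ->] := tensor_ofP x; have [t ->] := tensor_ofP y.
  rewrite -tensor_ofZ -tensor_ofD !h_pi /S.
  rewrite big_cat big_map scaler_sumr; congr (_ + _).
  by apply: eq_bigr => p _ /=; rewrite bZl.
pose H := GRing.isLinear.Build _ _ _ _ h hL.
pose hl : {linear tensor -> P} := HB.pack h H.
exists hl; split=> [m n|h' h'b x].
  by rewrite /= h_pi /S big_seq1.
rewrite (tensor_sum_pure x) !linear_sum; apply: eq_bigr => p _.
by rewrite h'b /= h_pi /S big_seq1.
Qed.

End Tensor.

(* id # f on representatives; independence of the representative is
   tensor_map_pi. *)
Section TensorMap.
Variables (R : comNzRingType) (M N N' : lmodType R) (f : {linear N -> N'}).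

Definition tensor_map (x : tensor M N) : tensor M N' :=
  tensor_of [seq (p.1, f p.2) | p <- repr x].

Lemma tensor_map_pi s :
  tensor_map (tensor_of s) = tensor_of [seq (p.1, f p.2) | p <- s].
Proof.
apply/tensor_of_eq; move: (repr _) (tensor_repr s) => t.
elim=> {s t} /=.
- by move=> s; exact: tensor_refl.
- by move=> s t _; exact: tensor_sym.
- by move=> s t u _ st _; exact: tensor_trans.
- by move=> s s' t t' _ ss _ tt; rewrite !map_cat; exact: tensor_cat.
- by move=> s t; rewrite !map_cat; exact: tensor_comm.
- by move=> n; exact: tensor_0l.
- by move=> m m' n; exact: tensor_Dl.
- by move=> m n n'; rewrite linearD; exact: tensor_Dr.
- by move=> a m n; rewrite linearZ; exact: tensor_Z.
Qed.

Fact tensor_map_is_linear : linear tensor_map.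
Proof.
move=> a x y; have [s ->] := tensor_ofP x; have [t ->] := tensor_ofP y.
rewrite -tensor_ofZ -tensor_ofD !tensor_map_pi.
by rewrite -tensor_ofZ -tensor_ofD map_cat /tensor_scale_seq -!map_comp.
Qed.

HB.instance Definition _ :=
  GRing.isLinear.Build R (tensor M N) (tensor M N') _ tensor_map
    tensor_map_is_linear.

End TensorMap.

Arguments tensor_map {R} M {N N'} f x.

(* Smallest element of a set of naturals in nat + {oo}, with None for oo,
   the value on the empty set. *)
Definition least (A : set nat) : option nat :=
  match pselect (exists n, n \in A) with
  | left exA => Some (ex_minn exA)
  | right _ => None
  end.

Definition le_oo (d : option nat) (n : nat) : bool :=
  if d is Some m then (m <= n)%N else false.

(* Supremum in nat + {oo}. *)
Definition sup_oo (A : set (option nat)) : option nat :=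
  least [set n | forall d, A d -> le_oo d n].

Section WeakDimension.
Variable R : comNzRingType.

Definition flat (M : lmodType R) : Prop :=
  forall (A B : lmodType R) (f : {linear A -> B}),
    injective f -> injective (tensor_map M f).

(* 0 -> F n -> ... -> F 0 -> M -> 0, continued by zero modules beyond n, so
   that exactness at F n includes the injectivity of F n -> F (n - 1). *)
Definition has_flat_resolution (M : lmodType R) (n : nat) : Prop :=
  exists (F : nat -> lmodType R) (d : forall i, {linear F i.+1 -> F i})
         (e : {linear F 0%N -> M}),
    [/\ forall i, flat (F i),
        forall i, (n < i)%N -> forall x : F i, x = 0,
        forall y, exists x, e x = y,
        forall x, e x = 0 <-> exists y, d 0%N y = x &
        forall i x, d i x = 0 <-> exists y, d i.+1 y = x].

Definition flat_dim (M : lmodType R) : option nat :=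
  least [set n | has_flat_resolution M n].

Definition weak_gldim : option nat :=
  sup_oo [set d | exists M : lmodType R, d = flat_dim M].

End WeakDimension.

Arguments weak_gldim R : clear implicits.

(* Main.v *)
Require Import Defs.
From HB Require Import structures.
From mathcomp Require Import all_boot all_order all_algebra.
From mathcomp Require Import boolp classical_sets.
From mathcomp Require Import ring zify.

Set Implicit Arguments.
Unset Strict Implicit.
Unset Printing Implicit Defensive.

Import GRing.Theory.
Local Open Scope classical_set_scope.
Local Open Scope ring_scope.

(** A bound n on the weak global dimension would give every module a flat
    resolution of length n.  It is refuted by following one obstruction along
    such a resolution.

    If xu = 0 in a flat module F, then u lies in (0 : x)F; more generally, xu in JF forces u in (J : x)F (flat_colon).  In a module M, the
    obstruction is an element v with xv = 0 and v outside (0 : x)M.  If u lifts v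
    to a flat cover F -> M with kernel K, then w = xu lies in K, and for an
    element c with cx = 0 it satisfies cw = 0.  If w were in (0 : c)K, and
    (0 : c) in J + Rx, then v would lie in (J : x)M (flat_exact_colon).  So an
    obstruction for x in M yields an obstruction for c in the first syzygy K, as
    soon as (0 : c) lies in J + Rx and (J : x) in (0 : x).  After n + 1 steps
    it would live in the zero module (resolution_induction).  Pairs x, c with
    these two properties are found among the powers of one nilpotent element b,
    and M is a principal ideal generated by (a multiple of) a power of b.

    What a local Gaussian ring offers for this is that, given a and b, one of
    them is a multiple of the other up to an element of square zero orthogonal
    to that other (local_gaussian_compare).  The argument depends on whether the
    nilpotency index is bounded in the localization at the nilradical.

    If it is unbounded there, it is unbounded in R, and J = 0 works
    approximately.  If m is the last exponent with a nonzero power of b, and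
    i + j = m with j > 0, then b (0 : b^j) is in (b^i), because of bz and a
    positive power of b one always divides the other (power_compare).  Each
    syzygy costs a factor b^2, which is harmless when m is large compared with n
    (no_flat_resolution_long).

    If it is bounded, everything is done up to multiplication by non-nilpotent
    elements, which amounts to working in the localization.  For b of maximal
    index there, the maximal ideal is generated by b and by elements of square
    zero killed by b (nil_decompose).  Let p be the last exponent for which the
    power of b survives; then p > 0, since a vanishing localization of the
    nilradical would give the nilradical square zero.  An ideal J maximal among those avoiding the surviving power b^p absorbs the
    elements killed by b, and the pairs b^i, b^(p + 1 - i) work exactly, for
    every n (no_flat_resolution_short). *)

(** * Local Gaussian rings *)

Section Ideals.
Variable R : comNzRingType.
Implicit Types (I J T : set R).

Lemma is_ideal_principal (x : R) : is_ideal [set y | exists r, y = r * x].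
Proof.
split=> [|_ _ [r ->] [s ->]|a _ [r ->]]; first by exists 0; rewrite mul0r.
  by exists (r + s); rewrite mulrDl.
by exists (a * r); rewrite mulrA.
Qed.

Lemma max_ideal_avoiding I T : is_ideal I -> (forall x, I x -> ~ T x) ->
  exists J, [/\ is_ideal J, I `<=` J, forall x, J x -> ~ T x &
    forall y, ~ J y -> exists j r, J j /\ T (j + r * y)].
Proof.
move=> [I0 ID IM] IT.
pose P (X : set R) := [/\ forall x y, X x -> X y -> X (x + y),
  forall a x, X x -> X (a * x), forall x, X x -> ~ T x &
  forall x, X x -> I `<=` X].
have [|A [[AD AM AT AI] Amax]] := @Zorn_bigcup R P.
  move=> F FP Ftot; split.
  - move=> x y [X FX Xx] [Y FY Yy].
    have [XY|YX] := Ftot _ _ FX FY.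
      by exists Y => //; have [+ _ _ _] := FP _ FY; apply=> //; exact: XY.
    by exists X => //; have [+ _ _ _] := FP _ FX; apply=> //; exact: YX.
  - by move=> a x [X FX Xx]; exists X => //; have [_ + _ _] := FP _ FX; apply.
  - by move=> x [X FX Xx]; have [_ _ + _] := FP _ FX; apply.
  - move=> x [X FX Xx] z Iz; exists X => //; have [_ _ _ +] := FP _ FX.
    by move=> /(_ _ Xx); apply.
(* The empty set satisfies P, but it is not maximal: I is larger. *)
have [a Aa] : exists a, A a.
  apply: contrapT => nA; apply: (Amax I); last by split=> // x _ y.
  split; last by move=> /(_ _ I0) A0; apply: nA; exists 0.
  by move=> x Ax; case: nA; exists x.
have A0 : A 0 by rewrite -(mul0r a); apply: AM.
exists A; split=> //; first exact: AI Aa.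
move=> y Ay; apply: contrapT => nT.
apply: (Amax [set z | exists j r, A j /\ z = j + r * y]).
  split; last first.
    by move=> /(_ y) H; apply: Ay; apply: H; exists 0, 1; split=> //; ring.
  by move=> x Ax; exists x, 0; split=> //; ring.
split.
- move=> _ _ [j [r [Aj ->]]] [k [s [Ak ->]]].
  by exists (j + k), (r + s); split; [exact: AD | ring].
- move=> b _ [j [r [Aj ->]]].
  by exists (b * j), (b * r); split; [exact: AM | ring].
- by move=> _ [j [r [Aj ->]]] Tx; apply: nT; exists j, r.
- by move=> _ _ z Iz; exists z, 0; split; [exact: AI Aa _ Iz | ring].
Qed.

Lemma local_unit (r : R) : local_ring R ->
  (exists s, s * r = 1) \/ (exists s, s * (1 - r) = 1).
Proof.
case=> m [_ mU]; apply: contrapT => nU.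
have max (x : R) : (forall s, s * x <> 1) -> exists2 J, is_maximal_ideal J & J x.
  move=> nx; have [|J [Ji xJ J1 Jmax]] :=
    @max_ideal_avoiding _ [set 1] (is_ideal_principal x).
    by move=> _ [s ->] /nx.
  exists J; last by apply: xJ; exists 1; rewrite mul1r.
  split=> // [JT|K [K0 KD KM] JK KT].
    by apply: (J1 1) => //; rewrite JT.
  apply/seteqP; split=> // y Ky; apply: contrapT => /Jmax [j [s [Jj /= jE]]].
  apply: KT; apply/seteqP; split=> // z _; rewrite -(mulr1 z) -jE.
  by apply/KM/KD; [exact: JK | exact: KM].
have [|J Jm Jr] := max r; first by move=> s sE; apply: nU; left; exists s.
have [|K Km Kr] := max (1 - r); first by move=> s sE; apply: nU; right; exists s.
have [[_ JD _] JT _] := Jm; apply: JT; apply/seteqP; split=> // z _.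
have J1 : J 1 by rewrite -(subrK r 1); apply: JD; rewrite // -(mU _ Jm) (mU _ Km).
by rewrite -(mulr1 z); have [[_ _ JM] _ _] := Jm; apply: JM.
Qed.

End Ideals.

Section GaussianPairs.
Variable R : comNzRingType.
Hypotheses (hlocal : local_ring R) (hgauss : gaussian_ring R).
Implicit Types a b c d r x y : R.

(** The Gaussian property for the two linear polynomials aX + b and cX + d. *)
Lemma gaussian_linear a b c d : exists u v w,
  a * d = u * (a * c) + v * (a * d + b * c) + w * (b * d).
Proof.
pose f : {poly R} := a%:P * 'X + b%:P; pose g : {poly R} := c%:P * 'X + d%:P.
have fgE : f * g = (a * c)%:P * 'X^2 + (a * d + b * c)%:P * 'X + (b * d)%:P.
  by rewrite /f /g !rmorphD !rmorphM /=; ring.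
pose I := [set z | exists u v w,
  z = u * (a * c) + v * (a * d + b * c) + w * (b * d)].
have Ii : is_ideal I.
  split=> [|_ _ [u [v [w ->]]] [u' [v' [w' ->]]]|r _ [u [v [w ->]]]].
  - by exists 0, 0, 0; ring.
  - by exists (u + u'), (v + v'), (w + w'); ring.
  - by exists (r * u), (r * v), (r * w); ring.
apply: (@smallest_sub R (@is_ideal R) [set z | exists i : nat, z = (f * g)`_i] I) => //.
  move=> _ [i ->]; rewrite fgE !coefD !coefCM coefX coefXn coefC.
  case: i => [|[|[|i]]] /=.
  - by exists 0, 0, 1; ring.
  - by exists 0, 1, 0; ring.
  - by exists 1, 0, 0; ring.
  - by exists 0, 0, 0; ring.
change (content (f * g) (a * d)); rewrite -hgauss.
apply: sub_smallest; first by move=> x; exact.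
exists a, d; split=> //; apply: sub_smallest.
- by move=> x; exact.
- by exists 1%N; rewrite coefD coefCM coefX coefC mulr1 addr0.
- by move=> x; exact.
- by exists 0%N; rewrite coefD coefCM coefX coefC mulr0 add0r.
Qed.

Lemma local_solve r y z : y = z + r * y ->
  (exists s, y = s * z) \/ (exists s, s * r = 1).
Proof.
move=> yE; have [|[s sE]] := local_unit r hlocal; [by right | left; exists s].
have -> : z = (1 - r) * y by rewrite mulrBl mul1r {1}yE addrK.
by rewrite mulrA sE mul1r.
Qed.

(** With c = b - ta the relation becomes c(c + ta) = ua^2.  The pair a, c
    times the pair c, -ua gives ua^2 and hence c^2 in (ac), say c^2 = wac.  If
    w is a unit then e = wa - c is orthogonal to c, and the pairs e, c and c, e
    put e^2 in (e^2 + c^2) = (a^2). *)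
Lemma mul_dvd_sqr_of_monic a b t u : b ^+ 2 = t * (a * b) + u * a ^+ 2 ->
  exists r, a * b = r * a ^+ 2.
Proof.
move=> b2; pose c := b - t * a.
have c2 : c ^+ 2 = u * a ^+ 2 - t * (a * c) by rewrite /c sqrrB b2; ring.
suff [r acE] : exists r, a * c = r * a ^+ 2.
  by exists (r + t); rewrite mulrDl -acE /c; ring.
have [U [V [W ]]] := gaussian_linear a c c (- u * a).
rewrite (_ : a * (- u * a) + c * c = - t * (a * c)); last first.
  by rewrite (_ : c * c = c ^+ 2) // c2; ring.
move=> ua2; pose w := - (U - V * t - W * u) - t.
have {}c2 : c ^+ 2 = w * (a * c).
  rewrite c2 (_ : u * a ^+ 2 = - (a * (- u * a))); last by ring.
  by rewrite ua2 /w; ring.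
have [r [v1 [s ]]] := gaussian_linear a c a (- c).
rewrite (_ : a * - c + c * a = 0) ?mulr0 ?addr0; last by ring.
move=> acE; have {}acE : a * c = - r * a ^+ 2 + s * w * (a * c).
  have -> : s * w * (a * c) = s * c ^+ 2 by rewrite c2; ring.
  by rewrite -[LHS]opprK -mulrN acE; ring.
have [[q qE]|[q qE]] := local_solve acE; first by exists (q * - r); rewrite qE; ring.
pose e := w * a - c.
have ec : e * c = 0.
  by rewrite (_ : e * c = w * (a * c) - c ^+ 2); [rewrite c2 subrr | rewrite /e; ring].
have [u1 [v [w1 ]]] := gaussian_linear e c c e.
rewrite (_ : e * c = 0) // (_ : c * e = 0); last by rewrite mulrC.
rewrite !mulr0 add0r addr0 => e2.
have v2 : e * e + c * c = w ^+ 2 * a ^+ 2.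
  rewrite (_ : w ^+ 2 * a ^+ 2 = (e + c) ^+ 2); last by rewrite /e; ring.
  by rewrite sqrrD ec; ring.
exists (q * s * ((1 - v) * w ^+ 2)).
have -> : a * c = q * s * c ^+ 2 by rewrite c2 -[LHS]mul1r -qE; ring.
have -> : c ^+ 2 = (1 - v) * (e * e + c * c) by rewrite mulrBl mul1r -e2; ring.
by rewrite v2; ring.
Qed.

(** Writing c = b - ra, the relation ac = 0 turns c^2 = ya^2 into
    (aX + c)(cX - ya) = 0, so all products of coefficients vanish. *)
Lemma gaussian_orthogonal a b : (exists r, a * b = r * a ^+ 2) ->
  (exists s, b ^+ 2 = s * a ^+ 2) ->
  exists r, a * (b - r * a) = 0 /\ (b - r * a) ^+ 2 = 0.
Proof.
move=> [r abE] [s bE]; exists r; set c := b - r * a.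
have ac : a * c = 0 by rewrite /c mulrBr abE; ring.
split=> //; pose y := s - 2%:R * r * r + r ^+ 2.
have c2 : c ^+ 2 = y * a ^+ 2.
  rewrite /c sqrrB bE (_ : b * (r * a) = r * (a * b)); last by ring.
  by rewrite abE /y; ring.
have [u [v [w ]]] := gaussian_linear a c c (- y * a).
rewrite ac (_ : a * (- y * a) + c * c = 0); last first.
  by rewrite (_ : c * c = c ^+ 2) // c2; ring.
rewrite (_ : c * (- y * a) = - y * (a * c)); last by ring.
rewrite ac !mulr0 !addr0 => yE.
by rewrite c2 (_ : y * a ^+ 2 = - (a * (- y * a))); [rewrite yE oppr0 | ring].
Qed.

(** Of two elements, one is a multiple of the other up to an element of
    square zero orthogonal to it.  This replaces the comparability of
    valuation rings. *)
Lemma local_gaussian_compare a b :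
  (exists r, a * (b - r * a) = 0 /\ (b - r * a) ^+ 2 = 0) \/
  (exists r, b * (a - r * b) = 0 /\ (a - r * b) ^+ 2 = 0).
Proof.
have main x y : (exists t u, y ^+ 2 = t * (x * y) + u * x ^+ 2) ->
    exists r, x * (y - r * x) = 0 /\ (y - r * x) ^+ 2 = 0.
  move=> [t [u y2]]; have [r xyE] := mul_dvd_sqr_of_monic y2.
  apply: gaussian_orthogonal; first by exists r.
  by exists (t * r + u); rewrite y2 xyE; ring.
have [U [V [W ]]] := gaussian_linear a b b a.
have [[s sE]|[s sE]] := local_unit V hlocal => aE.
  left; apply: main; exists (- s * (U + W)), (s * (1 - V)).
  rewrite -[LHS]mul1r -{1}sE.
  have -> : s * V * b ^+ 2 = s * (V * (a * a + b * b) - V * (a * a)) by ring.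
  rewrite (_ : V * (a * a + b * b) = a * a - U * (a * b) - W * (b * a)); first by ring.
  by rewrite [X in _ = X - _ - _]aE; ring.
right; apply: main; exists (s * (U + W)), (s * V).
rewrite -[LHS]mul1r -{1}sE (_ : s * _ * _ = s * (a * a - V * (a * a))); last by ring.
rewrite [X in s * (X - _)]aE; ring.
Qed.

Local Notation nil := (nilradical R).

Lemma mul_dvd_sqr x y :
  (exists r, x * y = r * x ^+ 2) \/ (exists r, x * y = r * y ^+ 2).
Proof.
have [[r [rE _]]|[r [rE _]]] := local_gaussian_compare x y; [left | right];
  exists r; apply/eqP; rewrite -subr_eq0 -rE; apply/eqP; ring.
Qed.

Lemma mul_sqr0 x y : x ^+ 2 = 0 -> y ^+ 2 = 0 -> x * y = 0.
Proof.
by move=> x2 y2; have [[r ->]|[r ->]] := mul_dvd_sqr x y; rewrite ?x2 ?y2 mulr0.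
Qed.

(** If xy = 0 and y = rx + d with xd = 0 = d^2, then rx^2 = 0 and so
    y^2 = d^2 = 0. *)
Lemma sqr0_of_mul0 x y : x * y = 0 -> x ^+ 2 = 0 \/ y ^+ 2 = 0.
Proof.
have main u v r : u * v = 0 -> u * (v - r * u) = 0 -> (v - r * u) ^+ 2 = 0 ->
    v ^+ 2 = 0.
  move=> uv ; rewrite mulrBr uv => ru2.
  rewrite (_ : _ ^+ 2 = v ^+ 2 - 2%:R * r * (u * v) + r * (u * (r * u))); last by ring.
  by move/eqP: ru2; rewrite sub0r oppr_eq0 => /eqP ->; rewrite uv !mulr0 subr0 addr0.
move=> xy; have [[r [H1 H2]]|[r [H1 H2]]] := local_gaussian_compare x y.
  by right; exact: main H1 H2.
by left; apply: main H1 H2; rewrite mulrC.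
Qed.

Lemma nil_prime x y : nil (x * y) -> nil x \/ nil y.
Proof.
move=> [n]; rewrite exprMn => /sqr0_of_mul0 [] /=; rewrite -exprM => ?.
  by left; exists (n * 2)%N.
by right; exists (n * 2)%N.
Qed.

Lemma nilMr a x : nil x -> nil (a * x).
Proof. by move=> [n xn]; exists n; rewrite exprMn xn mulr0. Qed.

Lemma nilD x y : nil x -> nil y -> nil (x + y).
Proof.
move=> [n xn] [m ym].
have main u v r k : u ^+ k = 0 -> u * (v - r * u) = 0 -> (v - r * u) ^+ 2 = 0 ->
    nil (u + v).
  move=> uk; set d := v - r * u => ud d2; exists (k * 2)%N; rewrite mulnC exprM.
  rewrite (_ : u + v = (1 + r) * u + d); last by rewrite /d; ring.
  rewrite sqrrD d2 addr0 -mulrA ud mulr0 mul0rn addr0.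
  by rewrite -exprM mulnC exprM exprMn uk mulr0 expr0n.
have [[r [H1 H2]]|[r [H1 H2]]] := local_gaussian_compare x y.
  exact: main xn H1 H2.
by rewrite addrC; exact: main ym H1 H2.
Qed.

Lemma nil_fixed a y : nil a -> y = a * y -> y = 0.
Proof.
move=> [n an] yE; have -> : y = a ^+ n * y; last by rewrite an mul0r.
by elim: n {an} => [|n IHn]; rewrite ?mul1r // exprSr -mulrA -yE.
Qed.

(** After multiplication by b, the powers of b are comparable with every
    element: if b = pz + q with zq = 0 = q^2, then bq = 0. *)
Lemma power_compare b z l :
  (exists r, b ^+ l.+1 = r * (b * z)) \/ (exists r, b * z = r * b ^+ l.+1).
Proof.
elim: l z => [|l IHl] z; first by right; exists z; rewrite mulrC.
have [[p [zq q2]]|[p [bq _]]] := local_gaussian_compare z b.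
  left; exists (p * b ^+ l).
  have bq : b * (b - p * z) = 0.
    by rewrite -[X in X * _](subrK (p * z)) mulrDl -expr2 q2 add0r -mulrA zq mulr0.
  have b2 : b * b = p * (b * z).
    by apply/eqP; rewrite -subr_eq0 -bq; apply/eqP; ring.
  by rewrite exprSr exprSr -mulrA b2; ring.
have bz : b * z = p * (b * b).
  by apply/eqP; rewrite -subr_eq0 -bq; apply/eqP; ring.
have [[r rE]|[r rE]] := IHl p; [left | right]; exists r.
  by rewrite exprS rE bz; ring.
rewrite bz (_ : p * (b * b) = b * (b * p)); last by ring.
by rewrite rE [in RHS]exprS; ring.
Qed.

(** In the comparison of by with b^(i + 1), a multiple of by equal to
    b^(i + 1) is excluded: b^j kills y but not b^i. *)
Lemma mul_ann_power b y i j : (0 < j)%N -> b ^+ (i + j) != 0 -> b ^+ j * y = 0 ->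
  exists z, b * y = z * b ^+ i.+1.
Proof.
case: j => // j _ bij by0; have [[r rE]|//] := power_compare b y i.
case/eqP: bij; rewrite addnS -addSn exprD rE.
rewrite (_ : _ * _ = r * (b ^+ j.+1 * y)); first by rewrite by0 mulr0.
by rewrite exprS; ring.
Qed.

End GaussianPairs.

(** * Flat modules and resolutions *)

Section IdealModule.
Variable R : comNzRingType.

Section Sub.
Variables (I : set R) (Ii : is_ideal I).

(** The proof argument makes the closure instance below available for the
    predicate alone. *)
Definition ideal_pred of is_ideal I : {pred R^o} := fun x : R^o => `[< I x >].

Fact ideal_pred_closed : GRing.submod_closed (ideal_pred Ii).
Proof.
have [I0 ID IM] := Ii; split; first exact/asboolP.
move=> a x y /asboolP Ix /asboolP Iy; apply/asboolP.
by apply: ID => //; exact: IM.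
Qed.

HB.instance Definition _ :=
  GRing.isSubmodClosed.Build R R^o (ideal_pred Ii) ideal_pred_closed.

Definition ideal_mod : Type := {x : R^o | x \in ideal_pred Ii}.

HB.instance Definition _ := SubType.on ideal_mod.
HB.instance Definition _ := Choice.on ideal_mod.
HB.instance Definition _ := [SubChoice_isSubLmodule of ideal_mod by <:].

Definition ideal_val : ideal_mod -> R^o := val.

Fact ideal_val_is_linear : linear ideal_val.
Proof. by move=> a x y; rewrite /ideal_val linearP. Qed.

HB.instance Definition _ :=
  GRing.isLinear.Build R ideal_mod R^o _ ideal_val ideal_val_is_linear.

Lemma ideal_val_inj : injective ideal_val. Proof. exact: val_inj. Qed.

Lemma ideal_valP (x : ideal_mod) : I (ideal_val x).
Proof. by apply/asboolP; have := valP x. Qed.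

Lemma ideal_val_surj (x : R) : I x -> exists y, ideal_val y = x.
Proof.
move=> Ix; have Ix' : (x : R^o) \in ideal_pred Ii by exact/asboolP.
by exists (Sub (x : R^o) Ix').
Qed.

End Sub.

Section Span.
Implicit Types (I J : set R) (M N : lmodType R).

Inductive ideal_span I M : M -> Prop :=
| span0 : ideal_span I 0
| spanD m m' : ideal_span I m -> ideal_span I m' -> ideal_span I (m + m')
| spanZ a m : I a -> ideal_span I (a *: m).

Lemma ideal_span_linear I M N (f : {linear M -> N}) m :
  ideal_span I m -> ideal_span I (f m).
Proof.
elim=> [|u v _ fu _ fv|a u Ia]; rewrite ?linear0 ?linearD ?linearZ.
- exact: span0.
- exact: spanD.
- exact: spanZ.
Qed.

Lemma ideal_span_scale I J M a (m : M) : (forall x, I x -> J (a * x)) ->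
  ideal_span I m -> ideal_span J (a *: m).
Proof.
move=> IJ; elim=> [|u v _ fu _ fv|b u Ib]; rewrite ?scaler0 ?scalerDr ?scalerA.
- exact: span0.
- exact: spanD.
- by apply: spanZ; exact: IJ.
Qed.

Lemma ideal_span_sub I J M (m : M) : I `<=` J -> ideal_span I m -> ideal_span J m.
Proof.
move=> IJ mI; rewrite -(scale1r m); apply: ideal_span_scale mI => x Ix.
by rewrite mul1r; exact: IJ.
Qed.

Definition colon I (x : R) : set R := [set y | I (y * x)].

Definition adjoin I (x : R) : set R := [set z | exists j r, I j /\ z = j + r * x].

Lemma is_ideal_colon I x : is_ideal I -> is_ideal (colon I x).
Proof.
move=> [I0 ID IM]; split; rewrite /colon /=; first by rewrite mul0r.
  by move=> y z Iy Iz; rewrite mulrDl; exact: ID.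
by move=> a y Iy; rewrite -mulrA; exact: IM.
Qed.

Lemma is_ideal_adjoin I x : is_ideal I -> is_ideal (adjoin I x).
Proof.
move=> [I0 ID IM]; split.
- by exists 0, 0; split=> //; ring.
- move=> _ _ [j [r [Ij ->]]] [k [s [Ik ->]]].
  by exists (j + k), (r + s); split; [exact: ID | ring].
- move=> a _ [j [r [Ij ->]]].
  by exists (a * j), (a * r); split; [exact: IM | ring].
Qed.

Lemma ideal_span_adjoin I x M (m : M) : ideal_span (adjoin I x) m ->
  exists m' k, ideal_span I m' /\ m = m' + x *: k.
Proof.
elim=> [|u v _ [u' [k [Iu ->]]] _ [v' [l [Iv ->]]]|_ u [j [r [Ij ->]]]].
- by exists 0, 0; split; [exact: span0 | rewrite scaler0 addr0].
- by exists (u' + v'), (k + l); split; [exact: spanD | rewrite scalerDr addrACA].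
- exists (j *: u), (r *: u); split; first exact: spanZ.
  by rewrite scalerDl scalerA mulrC.
Qed.

(** Tensor F with the inclusion of J + Rx in R.  If xf is in JF, then f # x
    and a sum of terms f_i # j_i with j_i in J have the same image in F # R, so
    they are equal in F # (J + Rx).  The bilinear map (f, rx + j) |-> rf into
    F / (J : x)F then shows that f vanishes in the quotient. *)
Lemma flat_colon J x (F : lmodType R) (f : F) : is_ideal J -> flat F ->
  ideal_span J (x *: f) -> ideal_span (colon J x) f.
Proof.
move=> Ji flatF; have [J0 JD JM] := Ji.
have [C0 CD CM] := is_ideal_colon x Ji.
pose A := ideal_mod (is_ideal_adjoin x Ji).
pose iota : {linear A -> R^o} := @ideal_val _ (is_ideal_adjoin x Ji).
have coefP (a : A) : exists r : R, J ((iota a : R) - r * x).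
  have [j [r [Jj aE]]] := ideal_valP a; exists r.
  by rewrite /iota /= aE (_ : _ - _ = j) //; ring.
pose coef a := projT1 (cid (coefP a)).
have coefE a : J ((iota a : R) - coef a * x) by rewrite /coef; case: cid.
have coefI (a : A) : J (iota a) -> colon J x (coef a).
  move=> Ja; rewrite /colon /= (_ : _ * x = iota a + (-1) * ((iota a : R) - coef a * x)).
    by apply: JD => //; exact: JM.
  by ring.
pose phi (s : seq (F * A)) := \sum_(p <- s) coef p.2 *: p.1.
have spanN (u : F) : ideal_span (colon J x) u -> ideal_span (colon J x) (- u).
  by rewrite -scaleN1r; apply: ideal_span_scale => *; exact: CM.
have phi_rel s t : tensor_rel s t -> ideal_span (colon J x) (phi s - phi t).
  rewrite /phi; elim=> {s t} /=.
  - by move=> s; rewrite subrr; exact: span0.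
  - by move=> s t _ /spanN; rewrite opprB.
  - by move=> s t u _ st _ tu; rewrite -(subrKA (\sum_(p <- t) coef p.2 *: p.1)); exact: spanD.
  - move=> s s' t t' _ ss _ tt; rewrite !big_cat opprD addrACA; exact: spanD.
  - by move=> s t; rewrite !big_cat /= [X in _ - X]addrC subrr; exact: span0.
  - by move=> a; rewrite big_seq1 big_nil scaler0 subr0; exact: span0.
  - by move=> m m' a; rewrite !big_cons !big_nil /= !addr0 scalerDr subrr; exact: span0.
  - move=> m a a'; rewrite !big_cons !big_nil /= !addr0 -scalerDl -scalerBl.
    apply: spanZ; rewrite /colon /=.
    rewrite (_ : _ * x = ((iota a : R) - coef a * x) + ((iota a' : R) - coef a' * x)
                  + (-1) * ((iota (a + a') : R) - coef (a + a') * x)).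
      by apply: (JD); [exact: JD | exact: JM].
    by rewrite linearD /=; ring.
  - move=> b m a; rewrite !big_seq1 /= scalerA -scalerBl.
    apply: spanZ; rewrite /colon /=.
    rewrite (_ : _ * x = (-1) * (b * ((iota a : R) - coef a * x))
                  + ((iota (b *: a) : R) - coef (b *: a) * x)).
      by apply: JD => //; apply: (JM); exact: JM.
    by rewrite linearZ /= (_ : b *: (iota a : R^o) = b * iota a) //; ring.
have lift g : ideal_span J g -> exists t : seq (F * A),
    (forall p, p \in t -> J (iota p.2)) /\
    tensor_rel [:: (g, 1 : R^o)] [seq (p.1, iota p.2) | p <- t].
  elim=> [|u v _ [t [Jt tE]] _ [t' [Jt' tE']]|a u Ja].
  - by exists [::]; split=> //; exact: tensor_0l.
  - exists (t ++ t'); split.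
      by move=> p; rewrite mem_cat => /orP[/Jt|/Jt'].
    apply: tensor_trans; first exact: tensor_Dl.
    rewrite map_cat; exact: (tensor_cat tE tE').
  - have [|a' a'E] := @ideal_val_surj _ (is_ideal_adjoin x Ji) a.
      by exists a, 0; split=> //; ring.
    exists [:: (u, a' : A)]; split=> [p|].
      by rewrite inE => /eqP -> /=; rewrite /iota /= a'E.
    rewrite /= /iota /= a'E -[X in (u, X)](mulr1 (a : R)).
    exact: (tensor_Z a u (1 : R^o)).
move=> /lift [t [Jt tE]].
have [|x' x'E] := @ideal_val_surj _ (is_ideal_adjoin x Ji) x.
  by exists 0, 1; split=> //; ring.
have: tensor_rel [:: (f, x' : A)] t.
  apply/tensor_of_eq/(flatF A R^o iota (@ideal_val_inj _ _)).
  rewrite !tensor_map_pi; apply/tensor_of_eq/(tensor_trans _ tE).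
  rewrite /= /iota /= x'E -[X in (f, X)](mulr1 (x : R)).
  exact/tensor_sym/(tensor_Z x f (1 : R^o)).
move=> /phi_rel; rewrite /phi big_seq1 /= => ft.
have tI : ideal_span (colon J x) (\sum_(p <- t) coef p.2 *: p.1).
  rewrite big_seq; apply: (big_ind (fun u : F => ideal_span (colon J x) u)).
  - exact: span0.
  - by move=> *; exact: spanD.
  - by move=> p /Jt /coefI Cp; exact: spanZ.
have: ideal_span (colon J x) (coef x' *: f).
  by rewrite -(subrK (\sum_(p <- t) coef p.2 *: p.1) (coef x' *: f)); exact: spanD.
have x'I : colon J x (1 - coef x').
  by rewrite /colon /= mulrBl mul1r -[X in X - _]x'E; exact: coefE.
move=> fI; rewrite -[f]scale1r -(subrK (coef x') 1) scalerDl.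
by apply: spanD fI; exact: spanZ.
Qed.

End Span.

Section Resolution.
Implicit Types (F M N : lmodType R).

(** The syzygy step: over an exact sequence F' -> F -> M with F flat, a
    relation between F' and F with coefficients in J + Rx gives a relation
    with coefficients in (J : x) in M. *)
Lemma flat_exact_colon J x F' F M (d : {linear F' -> F}) (e : {linear F -> M})
    (u : F) (g : F') :
  is_ideal J -> flat F -> (forall y, e y = 0 <-> exists z, d z = y) ->
  ideal_span (adjoin J x) g -> d g = x *: u ->
  exists h, ideal_span (colon J x) h /\ e u = e h.
Proof.
move=> Ji flatF exact_de /ideal_span_adjoin [g' [k [Jg' ->]]] dgE.
exists (u - d k); split; last first.
  by rewrite linearB (_ : e (d k) = 0) ?subr0 //; apply/exact_de; exists k.
apply: flat_colon => //; rewrite scalerBr -dgE linearD linearZ addrK.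
exact: ideal_span_linear.
Qed.

(** The property P k is climbed along a resolution from its end, where the
    source of the differential is the zero module, to the augmentation. *)
Lemma resolution_induction
    (P : nat -> forall F M : lmodType R, {linear F -> M} -> Prop) M n :
  (forall (F N : lmodType R) (e : {linear F -> N}), (forall x : F, x = 0) ->
    P 0%N F N e) ->
  (forall k (F' F N : lmodType R) (d : {linear F' -> F}) (e : {linear F -> N}), flat F ->
    (forall y, e y = 0 <-> exists z, d z = y) -> P k F' F d -> P k.+1 F N e) ->
  has_flat_resolution M n ->
  exists (F : lmodType R) (e : {linear F -> M}),
    (forall y, exists x, e x = y) /\ P n.+1 F M e.
Proof.
move=> P0 PS [F [d [e [flatF F0 e_surj exact_e exact_d]]]].
exists (F 0%N), e; split=> //; apply: (PS) => //.
have main k i : (i + k = n)%N -> P k (F i.+1) (F i) (d i).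
  elim: k i => [|k IHk] i ikn; first by apply: P0; apply: F0; rewrite -ikn addn0.
  apply: (PS); [exact: flatF | exact: exact_d | apply: IHk].
  by rewrite addSnnS.
exact: main.
Qed.

Lemma has_flat_resolution_leq M m n : (m <= n)%N ->
  has_flat_resolution M m -> has_flat_resolution M n.
Proof.
move=> mn [F [d [e [flatF F0 e_surj exact_e exact_d]]]].
exists F, d, e; split=> // i ni; apply: F0; exact: leq_ltn_trans ni.
Qed.

Lemma weak_gldim_infinite :
  (forall n, exists M : lmodType R, ~ has_flat_resolution M n) ->
  weak_gldim R = None.
Proof.
move=> H; rewrite /weak_gldim /sup_oo /least; case: pselect => // exA.
exfalso; case: exA => n; rewrite inE => /= nA.
have [M] := H n; apply.
have := nA _ (ex_intro _ M erefl); rewrite /flat_dim /least.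
case: pselect => // exM; case: ex_minnP => m; rewrite inE /= => Mm _ mn.
exact: has_flat_resolution_leq Mm.
Qed.

Lemma ideal_span_principal I c (Ic := is_ideal_principal c) (m : ideal_mod Ic) :
  is_ideal I -> ideal_span I m -> exists y, I y /\ (ideal_val m : R) = y * c.
Proof.
move=> [I0 ID IM]; elim=> [|u v _ [y [Iy uE]] _ [z [Iz vE]]|a u Ia].
- by exists 0; rewrite linear0 mul0r.
- by exists (y + z); rewrite linearD /= uE vE mulrDl; split=> //; exact: ID.
- have [r uE] := ideal_valP u; exists (r * a); split; first exact: IM.
  by rewrite linearZ /= uE (_ : a *: (r * c : R^o) = a * (r * c)) //; ring.
Qed.

End Resolution.
End IdealModule.

(** * Nilpotent elements of unbounded index *)

Section LocalGaussian.
Variable R : comNzRingType.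
Hypotheses (hlocal : local_ring R) (hgauss : gaussian_ring R).
Implicit Types a b c d r s u x y z : R.

Local Notation nil := (nilradical R).

(** The test module is (b^j) with j slightly larger than twice n + 1, and the
    obstruction is b^j itself, killed by b^(m + 1 - j). *)
Lemma no_flat_resolution_long b m n :
    b ^+ m != 0 -> b ^+ m.+1 = 0 -> (n * 4 + 7 <= m)%N ->
  exists M : lmodType R, ~ has_flat_resolution M n.
Proof.
move=> bm bm1 nm; pose j := (n * 2 + 4)%N; pose i := (m.+1 - j)%N.
exists (ideal_mod (is_ideal_principal (b ^+ j))) => res.
have Z0 : is_ideal [set (0 : R)].
  by split=> [//|x y -> ->|a x ->]; rewrite ?addr0 ?mulr0.
(* No obstruction survives multiplication by b^(2k), k steps before the end
   of the resolution. *)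
pose P (k : nat) (F M : lmodType R) (e : {linear F -> M}) := forall i j,
  (0 < i)%N -> (0 < j)%N -> (i + j = m)%N -> forall u : F, e (b ^+ i *: u) = 0 ->
  exists g, ideal_span (colon [set 0] (b ^+ i)) g /\ e (b ^+ (k * 2) *: u) = e g.
have [||F [e [e_surj Pe]]] := @resolution_induction R P _ n _ _ res.
- move=> F M e F0 i' j' _ _ _ u _; exists 0; split; first exact: span0.
  by rewrite [_ *: u]F0.
- move=> k F' F M d e flatF exact_de IH i' j' i0 j0 ijm u /exact_de [y dy].
  have [||g [gI dg]] := IH j' i' j0 i0 _ (b *: y); first by rewrite addnC.
    rewrite !linearZ /= dy !scalerA -exprSr -exprD.
    by rewrite (_ : (_ + _ = m.+1)%N) ?bm1 ?scale0r //; lia.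
  apply: (@flat_exact_colon R [set 0] (b ^+ i') _ _ _ d e _ (b *: g)) => //.
    apply: ideal_span_scale gI => z zI.
    have [||w ->] := @mul_ann_power R hlocal hgauss b z i' j' j0.
    + by rewrite ijm.
    + by rewrite mulrC.
    + by exists 0, (w * b); split=> //; rewrite exprS; ring.
  rewrite linearZ /= -dg !linearZ /= dy !scalerA; congr (_ *: _).
  by rewrite mulSn !exprD; ring.
have [v vE] : exists v : ideal_mod (is_ideal_principal (b ^+ j)),
    (ideal_val v : R) = b ^+ j.
  by apply: ideal_val_surj; exists 1; rewrite mul1r.
have [u eu] := e_surj v.
have [||||g [gI eg]] := Pe i j.-1 _ _ _ u; rewrite /i /j; try lia.
  rewrite linearZ /= eu; apply: ideal_val_inj; rewrite linear0 linearZ /= vE.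
  by rewrite [_ *: _](_ : _ = b ^+ i * b ^+ j) // -exprD subnK ?bm1 // /j; lia.
have := ideal_span_linear e gI; rewrite -eg linearZ /= eu.
case/ideal_span_principal; first exact: is_ideal_colon.
rewrite linearZ /= vE => y [] /= yi.
rewrite [_ *: _](_ : _ = b ^+ (n.+1 * 2) * b ^+ j) // -exprD => bjE.
have [|||w bw] := @mul_ann_power R hlocal hgauss b y j.-1 i.
- by rewrite /i /j; lia.
- by rewrite (_ : (_ + _ = m)%N) // /i /j; lia.
- by rewrite mulrC.
have E : b ^+ (n.+1 * 2 + j).+1 = w * b * b ^+ (n.+1 * 2 + j).+1.
  rewrite {1}exprS bjE mulrA bw.
  rewrite -!mulrA -exprS -exprD; congr (w * b ^+ _); rewrite /j; lia.
have nb : nil (w * b) by apply: nilMr; exists m.+1.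
have := nil_fixed nb E; apply/eqP; apply: contraNneq bm => b0.
rewrite -(subnK (_ : ((n.+1 * 2 + j).+1 <= m)%N)); last by rewrite /j; lia.
by rewrite exprD b0 mulr0.
Qed.

(** * Nilpotent elements of bounded index *)

Section Bounded.

(** The kernel of the localization of R at its nilradical. *)
Definition negligible : set R := [set z | exists s, ~ nil s /\ s * z = 0].

Lemma not_nilM s t : ~ nil s -> ~ nil t -> ~ nil (s * t).
Proof. by move=> ns nt /(nil_prime hlocal hgauss) []. Qed.

Lemma not_nil1 : ~ nil 1.
Proof. by case=> n; rewrite expr1n; apply/eqP; exact: oner_neq0. Qed.

Lemma negligibleM a z : negligible z -> negligible (a * z).
Proof. by case=> s [ns sz]; exists s; split=> //; rewrite mulrCA sz mulr0. Qed.

Lemma negligible_cancel s z : ~ nil s -> negligible (s * z) -> negligible z.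
Proof.
by move=> ns [t [nt tE]]; exists (t * s); rewrite -mulrA; split=> //; exact: not_nilM.
Qed.

Lemma negligibleD y z : negligible y -> negligible z -> negligible (y + z).
Proof.
move=> [s [ns sE]] [t [nt tE]]; exists (s * t); split; first exact: not_nilM.
rewrite (_ : _ * _ = t * (s * y) + s * (t * z)); last by ring.
by rewrite sE tE !mulr0 addr0.
Qed.

(** The membership of m in I M uses finitely many elements of I, so the
    denominators have a common multiple. *)
Lemma ideal_span_denominators (I K : set R) (M : lmodType R) (m : M) :
  is_ideal K -> (forall y, I y -> exists s, ~ nil s /\ K (s * y)) ->
  ideal_span I m -> exists s, ~ nil s /\ ideal_span K (s *: m).
Proof.
move=> [K0 KD KM] IK; elim=> [|u v _ [s [ns Ku]] _ [t [nt Kv]]|a u Ia].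
- by exists 1; split; [exact: not_nil1 | rewrite scaler0; exact: span0].
- exists (s * t); split; first exact: not_nilM.
  rewrite scalerDr; apply: spanD.
    by rewrite mulrC -scalerA; apply: ideal_span_scale Ku => x; exact: KM.
  by rewrite -scalerA; apply: ideal_span_scale Kv => x; exact: KM.
- have [s [ns Ks]] := IK _ Ia; exists s; split=> //.
  by rewrite scalerA; exact: spanZ.
Qed.

Variables (p : nat) (b : R).
Hypotheses (p_gt0 : (0 < p)%N) (nil_b : nil b)
  (nil_pow : forall a, nil a -> negligible (a ^+ p.+1))
  (b_pow : ~ negligible (b ^+ p)).

Lemma negligible_powP k : negligible (b ^+ k) <-> (p < k)%N.
Proof.
split=> [bk|pk].
  rewrite ltnNge; apply/negP => kp; apply: b_pow.
  by rewrite -(subnK kp) exprD; exact: negligibleM.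
by rewrite -(subnK pk) exprD; apply/negligibleM/nil_pow.
Qed.

(** After localization at the nilradical the maximal ideal is generated by b
    and elements of square zero killed by b. *)
Lemma nil_decompose u : nil u -> exists s u' d,
  [/\ ~ nil s, s * u = u' * b + d, b * d = 0 & d ^+ 2 = 0].
Proof.
move=> nu; have [p1|p2] := leqP p 1.
  have {}p1 : p = 1%N by lia.
  have sqr a : nil a -> negligible (a ^+ 2) by move=> /nil_pow; rewrite p1.
  have [s [ns sE]] : negligible (b * u).
    by have [[r ->]|[r ->]] := mul_dvd_sqr hlocal hgauss b u; apply/negligibleM/sqr.
  have [t [nt tE]] := sqr u nu; exists (s * t), 0, (s * t * u); split.
  - exact: not_nilM.
  - by rewrite mul0r add0r.
  - by rewrite (_ : _ * _ = t * (s * (b * u))); [rewrite sE mulr0 | ring].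
  - by rewrite (_ : _ ^+ 2 = s ^+ 2 * t * (t * u ^+ 2)); [rewrite tE mulr0 | ring].
have [[r [H1 H2]]|[r [H1 H2]]] := local_gaussian_compare hlocal hgauss b u.
  exists 1, r, (u - r * b); split=> //; first exact: not_nil1.
  by ring.
have [nr|nr] := pselect (nil r); last first.
  exists r, 1, (r * u - b); split=> //.
  - by ring.
  - rewrite (_ : _ * _ = - ((b - r * u) ^+ 2 + r * (u * (b - r * u)))); last by ring.
    by rewrite H1 H2 mulr0 addr0 oppr0.
  - by rewrite -H2; ring.
(* Here the localized b would be a product of two nilpotents, so that its
   power p would be a multiple of a square of a power p. *)
case: b_pow; have bE k : b ^+ k.+2 = (r * u) ^+ k.+2.
  elim: k => [|k IHk].
    rewrite (_ : b ^+ 2 = (r * u) ^+ 2 + (b - r * u) ^+ 2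
      + 2%:R * r * (u * (b - r * u))); last by ring.
    by rewrite H1 H2 mulr0 !addr0.
  rewrite exprSr IHk [RHS]exprSr -(subrK (r * u) b) mulrDr.
  by rewrite exprSr -!mulrA H1 !mulr0 add0r.
rewrite -(subnK p2) addn2 bE -addn2 subnK //.
have [[t ->]|[t ->]] := mul_dvd_sqr hlocal hgauss r u;
  rewrite exprMn -exprM; apply: negligibleM;
  rewrite -(@subnK p.+1 (2 * p)) ?exprD; try lia; exact/negligibleM/nil_pow.
Qed.

(** Up to negligible elements and elements outside the nilradical, every
    element of bR is a power of b. *)
Lemma power_normal_form y : negligible (b * y) \/
  exists s u l, [/\ ~ nil s, ~ nil u, (l < p)%N & s * (b * y) = u * b ^+ l.+1].
Proof.
have main k : exists s, ~ nil s /\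
    ((exists u l, ~ nil u /\ s * (b * y) = u * b ^+ l.+1) \/
     exists z, s * (b * y) = z * b ^+ k.+1).
  elim: k => [|k [s [ns [H|[z zE]]]]].
  - by exists 1; split; [exact: not_nil1 | right; exists y; ring].
  - by exists s; split=> //; left.
  have [nz|nz] := pselect (nil z); last by exists s; split=> //; left; exists z, k.
  have [t [z' [d [nt tE bd _]]]] := nil_decompose nz.
  exists (t * s); split; first exact: not_nilM.
  right; exists z'; rewrite -mulrA zE mulrA tE.
  by rewrite mulrDl [d * _]mulrC exprSr -[in d in _ + d]mulrA bd mulr0 addr0 !exprSr; ring.
have [by0|by0] := pselect (negligible (b * y)); [by left | right].
have [s [ns [[u [l [nu E]]]|[z E]]]] := main p; last first.
  case: by0; apply: (negligible_cancel ns); rewrite E.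
  by apply/negligibleM/nil_pow.
exists s, u, l; split=> //; rewrite ltnNge; apply/negP => pl; apply: by0.
apply: (negligible_cancel ns); rewrite E; apply/negligibleM/negligible_powP.
by rewrite ltnS.
Qed.

Section AvoidingIdeal.
Variable J : set R.
Hypotheses (Ji : is_ideal J)
  (Javoid : forall s, ~ nil s -> ~ J (s * b ^+ p))
  (Jmax : forall y, ~ J y -> exists j r s, [/\ J j, ~ nil s & j + r * y = s * b ^+ p]).

Lemma avoiding_saturated s y : ~ nil s -> J (s * y) -> J y.
Proof.
have [J0 JD JM] := Ji; move=> ns Jsy; apply: contrapT => /Jmax [j [r [t [Jj nt E]]]].
apply: (Javoid (not_nilM ns nt)); rewrite -mulrA -E mulrDr.
by apply: (JD); [exact: JM | rewrite mulrCA; exact: JM].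
Qed.

Lemma avoiding_negligible z : negligible z -> J z.
Proof. by have [J0 _ _] := Ji; case=> s [ns sz]; apply: (avoiding_saturated ns); rewrite sz. Qed.

(** By the normal form, a nonnegligible multiple of b divides ub^p for some
    non-nilpotent u, and J avoids such elements. *)
Lemma avoiding_power y k : J (y * b ^+ k.+1) -> negligible (y * b ^+ k.+1).
Proof.
have [J0 JD JM] := Ji; move=> Jy.
have [by0|[s [u [l [ns nu lp E]]]]] := power_normal_form y.
  by rewrite exprS (_ : _ * _ = b ^+ k * (b * y)); [exact: negligibleM | ring].
have sE : s * (y * b ^+ k.+1) = u * b ^+ (l.+1 + k).
  by rewrite [in RHS]exprD [in RHS]mulrA -E exprS; ring.
apply: (negligible_cancel ns); rewrite sE; apply/negligibleM/negligible_powP.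
rewrite ltnNge; apply/negP => lkp; apply: (Javoid nu).
rewrite -(subnK lkp) exprD mulrCA -sE.
by apply: (JM); exact: JM.
Qed.

(** After localization, an element d killed by b generates a simple or zero
    module.  If d is not in J then J + dR contains sb^p for some non-nilpotent
    s, and the coefficient of d there cannot be nilpotent. *)
Lemma avoiding_socle d : negligible (b * d) ->
  exists s, ~ nil s /\ adjoin J (b ^+ p) (s * d).
Proof.
have [J0 JD JM] := Ji; move=> bd.
have [Jd|/Jmax [j [r [t [Jj nt E]]]]] := pselect (J d).
  exists 1; split; first exact: not_nil1.
  by exists d, 0; split=> //; ring.
have [nr|nr] := pselect (nil r); last first.
  exists r; split=> //; exists (-1 * j), t; split; first exact: JM.
  by rewrite -E; ring.
have nd : nil d.
  apply: contrapT => nd; suff /negligible_powP : negligible (b ^+ 1) by rewrite ltnS leqNgt p_gt0.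
  by apply: (negligible_cancel nd); rewrite mulrC.
have [s1 [u1 [d1 [ns1 E1 bd1 d1s]]]] := nil_decompose nd.
have [s2 [u2 [d2 [ns2 E2 bd2 d2s]]]] := nil_decompose nr.
case: (Javoid nt); rewrite -E; apply: (JD) => //; apply: avoiding_negligible.
apply: (negligible_cancel (not_nilM ns2 ns1)).
have -> : s2 * s1 * (r * d) = s2 * r * (s1 * d) by ring.
rewrite E2 E1 (_ : _ * _ = u2 * (b * (u1 * b + d1)) + u1 * (b * d2) + d2 * d1); last by ring.
rewrite bd2 (mul_sqr0 hlocal hgauss d2s d1s) mulr0 !addr0 -E1.
by rewrite (_ : _ * _ = u2 * s1 * (b * d)); [exact: negligibleM | ring].
Qed.

(** By the normal form, sy is a multiple of b^i plus an element killed by b,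
    and the latter is absorbed by J. *)
Lemma avoiding_annihilator y i : (i <= p)%N ->
  negligible (y * b ^+ (p.+1 - i)) -> exists s, ~ nil s /\ adjoin J (b ^+ i) (s * y).
Proof.
have [J0 JD JM] := Ji; move=> ip.
have widen z : adjoin J (b ^+ p) z -> adjoin J (b ^+ i) z.
  move=> [j [r [Jj ->]]]; exists j, (r * b ^+ (p - i)); split=> //.
  by rewrite -mulrA -exprD subnK.
have [/avoiding_socle [s [ns sy]] _|[s [u [l [ns nu lp E]]]]] := power_normal_form y.
  by exists s; split=> //; exact: widen.
rewrite subSn // => /(negligibleM s).
rewrite (_ : _ * _ = u * b ^+ (l + (p - i)).+1); last first.
  by rewrite -addSn [in RHS]exprD [in RHS]mulrA -E exprS; ring.
move=> /(negligible_cancel nu)/negligible_powP il.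
have [|t [nt /widen [j [r [Jj tE]]]]] := @avoiding_socle (s * y - u * b ^+ l).
  exists 1; split; first exact: not_nil1.
  by rewrite mul1r mulrBr mulrCA E exprS; ring.
exists (t * s); split; first exact: not_nilM.
exists j, (r + t * u * b ^+ (l - i)); split=> //.
rewrite mulrDl addrA -tE -mulrA [_ * b ^+ i](_ : _ = t * (u * b ^+ l)); first by ring.
by rewrite -!mulrA -exprD subnK //; lia.
Qed.

End AvoidingIdeal.

(** The test module is generated by c = s0 b^p, where the factor s0 makes bc
    vanish exactly and not just up to localization; the obstruction is c, killed
    by b. *)
Lemma no_flat_resolution_short n : exists M : lmodType R, ~ has_flat_resolution M n.
Proof.
have [s0 [ns0 s0E]] := nil_pow nil_b; pose c := s0 * b ^+ p.
exists (ideal_mod (is_ideal_principal c)) => res.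
have [|J [Ji _ Javoid Jmax]] :=
  @max_ideal_avoiding R _ [set s * b ^+ p | s in [set s | ~ nil s]] (is_ideal_principal 0).
  by move=> _ [r ->] [s ns E]; apply: b_pow; exists s; rewrite E mulr0.
have {}Javoid s : ~ nil s -> ~ J (s * b ^+ p) by move=> ns /Javoid; apply; exists s.
have {}Jmax y : ~ J y -> exists j r s, [/\ J j, ~ nil s & j + r * y = s * b ^+ p].
  by move=> /Jmax [j [r [Jj [s ns E]]]]; exists j, r, s.
pose ann i : set R := [set y | negligible (y * b ^+ i)].
have ann_ideal i : is_ideal (ann i).
  split; rewrite /ann /=.
  - by exists 1; split; [exact: not_nil1 | rewrite mul0r mulr0].
  - by move=> x y nx ny; rewrite mulrDl; exact: negligibleD.
  - by move=> a x nx; rewrite -mulrA; exact: negligibleM.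
pose P (k : nat) (F M : lmodType R) (e : {linear F -> M}) := forall i,
  (0 < i)%N -> (i <= p)%N -> forall u : F, e (b ^+ i *: u) = 0 ->
  exists s g, [/\ ~ nil s, ideal_span (ann i) g & e (s *: u) = e g].
have [||F [e [e_surj Pe]]] := @resolution_induction R P _ n _ _ res.
- move=> F M e F0 i _ _ u _; exists 1, 0; split; [exact: not_nil1 | exact: span0|].
  by rewrite [_ *: u]F0.
- move=> k F' F M d e flatF exact_de IH i i0 ip u /exact_de [y dy].
  have [|||s [g [ns gI dg]]] := IH (p.+1 - i)%N _ _ (s0 *: y); try lia.
    rewrite !linearZ /= dy !scalerA mulrAC -exprD subnK; last by lia.
    by rewrite mulrC s0E scale0r.
  have [|t [nt tg]] := ideal_span_denominators (is_ideal_adjoin (b ^+ i) Ji) _ gI.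
    by move=> z; exact: avoiding_annihilator.
  have [|h [hI hE]] := @flat_exact_colon R J (b ^+ i) _ _ _ d e (t * s * s0 *: u) _
    Ji flatF exact_de tg.
    rewrite linearZ /= -dg !linearZ /= dy !scalerA; congr (_ *: _); ring.
  exists (t * s * s0), h; split=> //; first by do 2?apply: not_nilM.
  apply: ideal_span_sub hI => z; rewrite /colon /ann /= -(prednK i0).
  exact: avoiding_power.
have [v vE] : exists v : ideal_mod (is_ideal_principal c), (ideal_val v : R) = c.
  by apply: ideal_val_surj; exists 1; rewrite mul1r.
have [u eu] := e_surj v.
have [//|s [g [ns gI eg]]] := Pe 1%N isT p_gt0 u.
  rewrite linearZ /= eu; apply: ideal_val_inj; rewrite linear0 linearZ /= vE.
  by rewrite [_ *: _](_ : _ = b * c) // /c mulrCA -exprS.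
have := ideal_span_linear e gI; rewrite -eg linearZ /= eu.
case/ideal_span_principal => // y []; rewrite linearZ /= vE => yb.
rewrite [_ *: _](_ : _ = s * c) // => sE.
have ny : nil y.
  apply: contrapT => ny.
  have /negligible_powP := negligible_cancel ny yb; lia.
apply: b_pow; apply: (negligible_cancel ns0); exists (s - y); split.
  move=> nsy; apply: ns; rewrite -(subrK y s); exact: nilD.
by rewrite mulrBl -/c sE subrr.
Qed.

End Bounded.
End LocalGaussian.

Unset Implicit Arguments.

(** * Infinite weak global dimension *)

Theorem mainTheorem1 (R : comNzRingType) (hlocal : local_ring R)
    (hgauss : gaussian_ring R) (hnonred : ~ reduced_ring R)
    (hN2 : ideal_mul (nilradical R) (nilradical R) <> [set 0]) :
  weak_gldim R = None.
Proof.
apply: weak_gldim_infinite => n.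
have [[q qN]|unbounded] :=
  pselect (exists q, forall a, nilradical R a -> negligible (a ^+ q)); last first.
  have [a [na a_pow]] : exists a, nilradical R a /\ ~ negligible (a ^+ (n * 4 + 7)).
    apply: contrapT => H; apply: unbounded; exists (n * 4 + 7)%N => a na.
    by apply: contrapT => Ha; apply: H; exists a.
  have exm : exists m, a ^+ m == 0 by case: na => m am; exists m; exact/eqP.
  case: (ex_minnP exm) => m am min_m.
  have a_pow' : a ^+ (n * 4 + 7) != 0.
    apply: contra_notN a_pow => /eqP ->; exists 1; split; first exact: not_nil1.
    by rewrite mulr0.
  have lt_m : (n * 4 + 7 < m)%N.
    rewrite ltnNge; apply: contra a_pow' => le_m.
    by rewrite -(subnK le_m) exprD (eqP am) mulr0.
  apply: (@no_flat_resolution_long R hlocal hgauss a m.-1 n); last by lia.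
    apply/negP => /min_m; lia.
  by rewrite prednK; [exact/eqP | lia].
have exq : exists q, `[< forall a, nilradical R a -> negligible (a ^+ q) >].
  by exists q; exact/asboolP.
case: (ex_minnP exq) => {qN}q /asboolP qN min_q.
have q2 : (1 < q)%N.
  rewrite ltnNge; apply/negP => q1; apply: hN2.
  have neg a : nilradical R a -> a ^+ 2 = 0.
    move=> na; have [s [ns sa]] : negligible a.
      have := negligibleM (a ^+ (1 - q)) (qN _ na).
      by rewrite -exprD subnK ?expr1.
    have [s2|//] := sqr0_of_mul0 hlocal hgauss sa.
    by case: ns; exists 2%N.
  apply/seteqP; split=> [z|_ ->]; last by move=> I [[I0 _ _] _].
  apply: (@smallest_sub R (@is_ideal R) _ [set 0]).
    by split=> [//|x y -> ->|a x ->]; rewrite ?addr0 ?mulr0.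
  by move=> _ [x [y [nx ny ->]]] /=; apply: mul_sqr0 => //; exact: neg.
have [b [nb b_pow]] : exists b, nilradical R b /\ ~ negligible (b ^+ q.-1).
  apply: contrapT => H; suff : (q <= q.-1)%N by lia.
  apply: min_q; apply/asboolP => a na; apply: contrapT => Ha; apply: H.
  by exists a.
apply: (@no_flat_resolution_short R hlocal hgauss q.-1 b) => //; first by lia.
by rewrite prednK //; lia.
Qed.
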